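(* Let $r\in\mathbb{N}$, $m_1,\ldots,m_r\in\mathbb{N}$, $m=\operatorname{lcm}(m_1,\ldots,m_r)$ and $\mathbf{a}=(a_1,\ldots,a_r)\in\mathbb{Z}^r$. Then $$\frac1m\sum_{k=1}^m c_{m_1}(k-a_1)\cdots c_{m_r}(k-a_r)=\sum_{d_1\mid m_1,\ldots,d_r\mid m_r}\frac{d_1\mu(m_1/d_1)\cdots d_r\mu(m_r/d_r)}{\operatorname{lcm}(d_1,\ldots,d_r)}N_{(\mathbf a)}(d_1,\ldots,d_r),$$ where $N_{(\mathbf a)}(d_1,\ldots,d_r)=1$ if $\gcd(d_i,d_j)\mid a_i-a_j$ for all $1\le i,j\le r$, and $N_{(\mathbf a)}(d_1,\ldots,d_r)=0$ otherwise.
   Context: For $n\in\mathbb{N}$ and $k\in\mathbb{Z}$, $c_n(k)=\sum_{1\le j\le n,\ \gcd(j,n)=1}\exp(2\pi i jk/n)$ is the Ramanujan sum. $\mu$ is the Möbius function. *)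

(* Defs.v *)
From mathcomp Require Import all_boot all_order all_algebra.
From mathcomp Require Import complex.
From mathcomp Require Import reals sequences trigo.

Set Implicit Arguments.
Unset Strict Implicit.
Unset Printing Implicit Defensive.

Import GRing.Theory Num.Theory.

Local Open Scope ring_scope.
Local Open Scope complex_scope.

(* exp (x + i y) = e^x (cos y + i sin y) *)
Definition expC (R : realType) (z : R[i]) : R[i] :=
  (expR (complex.Re z))%:C * (cos (complex.Im z) +i* sin (complex.Im z)).

Definition ramanujan_sum (R : realType) (n : nat) (k : int) : R[i] :=
  \sum_(1 <= j < n.+1 | coprime j n)
    expC (2 * (pi : R)%:C * 'i * j%:R * k%:~R / n%:R).

Definition squarefree (n : nat) : bool :=
  (0 < n)%N && ~~ has (fun p => p ^ 2 %| n)%N (primes n).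

Definition mobius (n : nat) : int :=
  if squarefree n then (-1) ^+ size (primes n) else 0.

Definition lcm_fam (r : nat) (d : 'I_r -> nat) : nat :=
  \big[lcmn/1%N]_(i < r) d i.

Definition N_compat (r : nat) (a : 'I_r -> int) (d : 'I_r -> nat) : nat :=
  if [forall i, forall j, ((gcdn (d i) (d j))%:Z %| a i - a j)%Z] then 1 else 0.

(* Main.v *)
Require Import Defs.
From mathcomp Require Import all_boot all_order all_algebra.
From mathcomp Require Import complex.
From mathcomp Require Import reals sequences exp trigo.
From mathcomp Require Import zify ring lra.

Import Order.TTheory GRing.Theory Num.Theory.
Local Open Scope ring_scope.
Local Open Scope complex_scope.

(* Moebius inversion over the common divisors of [j] and [n], combined with the
   orthogonality of roots of unity, gives
   [c_n(k) = \sum_(d | n, d | k) d * mu(n / d)].  Expanding the product of these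
   sums and exchanging summations reduces the mean value to counting the [k] in
   [1, m] with [d_i | k - a_i] for all [i].  By the Chinese remainder theorem for
   moduli that need not be coprime, this system is solvable exactly when
   [gcd(d_i, d_j) | a_i - a_j] for all [i, j], and then its solutions form one
   residue class modulo [lcm(d_1, ..., d_r)]. *)

(** * Moebius inversion *)

Lemma squarefreeP (n : nat) :
  reflect ((0 < n)%N /\ forall p, prime p -> ~~ (p ^ 2 %| n)%N) (squarefree n).
Proof.
apply: (iffP andP) => -[n_gt0 sq_n]; split=> //.
  move=> p p_pr; apply: contra sq_n => p2n; apply/hasP; exists p => //.
  by rewrite mem_primes p_pr n_gt0 (dvdn_trans _ p2n) // expnS dvdn_mulr.
by apply/hasPn=> p; rewrite mem_primes => /andP[/sq_n].
Qed.

(** As [p] does not divide [e], the product has one more prime factor and no new square of a prime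
    dividing it. *)
Lemma mobius_primeM (p e : nat) :
  prime p -> (0 < e)%N -> ~~ (p %| e)%N -> mobius (p * e) = - mobius e.
Proof.
move=> p_pr e_gt0 pNe; have p_gt0 := prime_gt0 p_pr.
have perm_pe : perm_eq (primes (p * e)) (p :: primes e).
  apply: uniq_perm; rewrite ?primes_uniq //= ?primes_uniq ?andbT.
    by rewrite mem_primes (negPf pNe) !andbF.
  by move=> q; rewrite primesM // primes_prime // !inE.
rewrite /mobius (perm_size perm_pe) /=.
suff ->: squarefree (p * e) = squarefree e.
  by case: ifP; rewrite ?oppr0 // exprS mulN1r.
apply/squarefreeP/squarefreeP => -[_ sq]; split; rewrite ?muln_gt0 ?p_gt0 //.
  by move=> q /sq; apply: contra => /dvdn_mull ->.
move=> q q_pr; have [->|qNp] := eqVneq q p; first by rewrite dvdn_pmul2l.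
by rewrite Gauss_dvdr ?sq // coprimeXl // prime_coprime // dvdn_prime2.
Qed.

Lemma mobius_sqr_dvd (p n : nat) : prime p -> (p ^ 2 %| n)%N -> mobius n = 0.
Proof.
by move=> p_pr p2n; rewrite /mobius; case: squarefreeP => // -[_ /(_ p p_pr)/negP].
Qed.

(* The divisors [e] with [p] not dividing [e] cancel against the [p * e]; the
   remaining ones are divisible by [p ^ 2]. *)
Lemma sum_mobius_divisors (n : nat) :
  (0 < n)%N -> \sum_(e <- divisors n) mobius e = (n == 1)%N%:R.
Proof.
move=> n_gt0; have [->|n_neq1] := eqVneq n 1%N.
  by rewrite big_seq1.
have [p p_pr p_n] : exists2 p, prime p & (p %| n)%N.
  by exists (pdiv n); rewrite ?pdiv_dvd // pdiv_prime // ltn_neqAle eq_sym n_neq1.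
have p_gt0 := prime_gt0 p_pr.
rewrite (bigID (fun e => p %| e)%N) /=.
rewrite (bigID (fun e => p ^ 2 %| e)%N) /= [X in X + _ + _]big1 ?add0r; last first.
  by move=> e /andP[_ /(mobius_sqr_dvd _ _ p_pr)].
rewrite -big_filter.
rewrite (perm_big [seq (p * e)%N | e <- divisors n & ~~ (p %| e)%N]) /=; last first.
  apply: uniq_perm; rewrite ?filter_uniq ?divisors_uniq //.
    rewrite map_inj_uniq ?filter_uniq ?divisors_uniq // => x y /eqP.
    by rewrite eqn_pmul2l // => /eqP.
  move=> x; rewrite mem_filter -dvdn_divisors //; apply/idP/mapP.
    case/andP=> /andP[/dvdnP[e ->]].
    rewrite mulnC dvdn_pmul2l // => pNe pe_n; exists e => //.
    by rewrite mem_filter pNe -dvdn_divisors // (dvdn_trans _ pe_n) // dvdn_mull.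
  case=> e; rewrite mem_filter -dvdn_divisors // => /andP[pNe e_n] ->.
  rewrite dvdn_mulr // dvdn_pmul2l // pNe /=.
  by rewrite Gauss_dvd ?p_n // prime_coprime.
rewrite big_map big_filter -big_split big_seq_cond big1 //= => e.
rewrite -dvdn_divisors // => /andP[/(dvdn_gt0 n_gt0) e_gt0 pNe].
by rewrite mobius_primeM // addNr.
Qed.

(** * Sums over divisors and multiples *)

Lemma perm_divisors_compl (n : nat) : (0 < n)%N ->
  perm_eq (divisors n) [seq (n %/ d)%N | d <- divisors n].
Proof.
move=> n_gt0; have divK d : (d %| n)%N -> (n %/ (n %/ d))%N = d.
  by move=> d_n; rewrite divnA // mulKn.
apply: uniq_perm; rewrite ?divisors_uniq //.
  rewrite map_inj_in_uniq ?divisors_uniq // => x y.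
  by rewrite -!dvdn_divisors // => /divK{2}<- /divK{2}<- ->.
move=> x; rewrite -dvdn_divisors //; apply/idP/mapP => [x_n|[d]].
  by exists (n %/ x)%N; rewrite -?dvdn_divisors ?divK // dvdn_div.
by rewrite -dvdn_divisors // => d_n ->; apply: dvdn_div.
Qed.

(** A common bound [N] gives all the divisor sums one index type, so that a product of them expands
    over finite functions. *)
Lemma big_divisors_ord (V : nmodType) (n N : nat) (F : nat -> V) :
  (0 < n)%N -> (n <= N)%N ->
  \sum_(d <- divisors n) F d = \sum_(d < N.+1 | (d %| n)%N) F d.
Proof.
move=> n_gt0 n_le; rewrite -(big_mkord (fun d => d %| n)%N) -big_filter.
apply: perm_big; apply: uniq_perm; rewrite ?divisors_uniq ?filter_uniq ?iota_uniq //.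
move=> d; rewrite mem_filter mem_index_iota -dvdn_divisors //=.
by case d_n: (d %| n)%N => //=; have := dvdn_leq n_gt0 d_n; lia.
Qed.

Lemma big_multiples (V : nmodType) (e q : nat) (F : nat -> V) : (0 < e)%N ->
  \sum_(1 <= j < (e * q).+1 | (e %| j)%N) F j = \sum_(1 <= j < q.+1) F (e * j)%N.
Proof.
move=> e_gt0; rewrite -big_filter -(big_map (muln e) xpredT).
apply: perm_big; apply: uniq_perm; rewrite ?filter_uniq ?iota_uniq //.
  by rewrite map_inj_uniq ?iota_uniq // => x y /eqP; rewrite eqn_pmul2l // => /eqP.
move=> j; rewrite mem_filter mem_index_iota; apply/idP/mapP.
  case/andP=> /dvdnP[x ->]; rewrite mulnC muln_gt0 !ltnS leq_pmul2l //.
  case/andP=> /andP[_ x0] xq.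
  by exists x; rewrite // mem_index_iota x0.
case=> x; rewrite mem_index_iota => /andP[x0 xq] ->.
by rewrite dvdn_mulr //= muln_gt0 e_gt0 x0 /= ltnS leq_pmul2l.
Qed.

(** Among any [L] consecutive integers exactly one lies in a given residue class; induction on the
    number [q] of blocks. *)
Lemma count_progression (L q : nat) (x : int) : (0 < L)%N ->
  (\sum_(1 <= k < (q * L).+1) (L%:Z %| (k%:Z - x)%R)%Z = q)%N.
Proof.
move=> L_gt0; rewrite big_add1 /=.
have block y : (\sum_(0 <= k < L) (L%:Z %| (k%:Z - y)%R)%Z = 1)%N.
  have yL : (`|(y %% L%:Z)%Z| < L)%N by lia.
  rewrite big_mkord (bigD1 (Ordinal yL)) //= big1 ?addn0.
    by rewrite gez0_abs ?modz_ge0 ?eqz_nat -?lt0n // -eqz_mod_dvd modz_mod eqxx.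
  move=> k /eqP k_ne; case: dvdzP => // -[z] zE; case: k_ne.
  apply: val_inj => /=; have ->: y = (- z) * L%:Z + k%:Z by lia.
  by rewrite modzMDl modz_small ?absz_nat //; have := ltn_ord k; lia.
elim: q => [|q IHq]; first by rewrite mul0n big_geq.
rewrite mulSn addnC (big_cat_nat (n := q * L)) ?leq_addr //= IHq.
rewrite -{1}[(q * L)%N]add0n big_addn addKn -addn1; congr addn.
(* Index [k] of the last block stands for the integer [k + q * L + 1], hence the shift of [x]. *)
rewrite -(block (x - 1 - (q * L)%:Z)); apply: eq_bigr => k _.
by congr (nat_of_bool (_ %| _)%Z); lia.
Qed.

(** * The Chinese remainder theorem for arbitrary moduli *)

Lemma dvdz_gcd_crt (A B : nat) (x y : int) :
  ((gcdn A B)%:Z %| x - y)%Z -> exists z : int, (A%:Z %| z - x)%Z && (B%:Z %| z - y)%Z.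
Proof.
case/dvdzP=> c xyE; have [u [v uvE]] := Bezoutz A%:Z B%:Z.
(* Since [x - y = c * (u * A + v * B)], this witness also equals [y + v * B * c]. *)
exists (x - u * A%:Z * c); apply/andP; split; apply/dvdzP.
  by exists (- u * c); ring.
exists (v * c); suff: x - y = u * A%:Z * c + v * B%:Z * c by lia.
by rewrite xyE -mulrDl uvE mulrC.
Qed.

(** Distributivity of the divisibility lattice, where meet is gcd and join is lcm. *)
Lemma gcdn_lcml (d a b : nat) : gcdn (lcmn a b) d = lcmn (gcdn a d) (gcdn b d).
Proof. exact: (@Order.meetUl _ natdvd). Qed.

(** Induction on [r]: a solution [x] for the tail, taken modulo the lcm [L] of its moduli, is merged
    with the first congruence by the case of two moduli. *)
Lemma crt_fam (r : nat) (a : 'I_r -> int) (d : 'I_r -> nat) :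
  (forall i j, ((gcdn (d i) (d j))%:Z %| a i - a j)%Z) ->
  exists x : int, forall i, ((d i)%:Z %| x - a i)%Z.
Proof.
elim: r a d => [|r IHr] a d compat; first by exists 0 => -[].
have [//|x xP] := IHr (fun i => a (lift ord0 i)) (fun i => d (lift ord0 i)).
pose L := lcm_fam (fun i => d (lift ord0 i)).
have : ((gcdn L (d ord0))%:Z %| x - a ord0)%Z.
  (* As gcd distributes over lcm, it suffices to treat each modulus of the tail separately. *)
  rewrite dvdzE /= /L /lcm_fam; apply: (big_ind (fun l => gcdn l (d ord0) %| _)%N).
  - by rewrite gcd1n dvd1n.
  - by move=> u v uP vP; rewrite gcdn_lcml dvdn_lcm uP vP.
  move=> i _; have gP := compat (lift ord0 i) ord0; have xPi := xP i.
  rewrite -[(_ %| _)%N]/((gcdn (d (lift ord0 i)) (d ord0))%:Z %| x - a ord0)%Z.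
  rewrite -(subrKA (a (lift ord0 i))) rpredD //.
  by apply: dvdz_trans xPi; rewrite dvdzE dvdn_gcdl.
case/dvdz_gcd_crt=> z /andP[zL z0]; exists z => i.
case: (unliftP ord0 i) => [j|] -> //.
rewrite -(subrKA x) rpredD //; apply: dvdz_trans zL.
by rewrite dvdzE /= (biglcmn_sup j).
Qed.

(** Given one solution [x], the system says that the lcm divides [k - x]. Conversely, any solution
    [k] forces compatibility through [(a i - k) + (k - a j)]. *)
Lemma count_crt (r : nat) (a : 'I_r -> int) (d : 'I_r -> nat) (M : nat) :
    (0 < M)%N -> (lcm_fam d %| M)%N ->
  (\sum_(1 <= k < M.+1) [forall i, ((d i)%:Z %| (k%:Z - a i)%R)%Z]
    = M %/ lcm_fam d * N_compat a d)%N.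
Proof.
move=> M_gt0 LM; have L_gt0 := dvdn_gt0 M_gt0 LM.
rewrite /N_compat; case: ifPn => [/forallP compat|/forallPn[i /forallPn[j ijP]]].
  have [i j|x xP] := @crt_fam _ a d; first exact: (forallP (compat i)).
  rewrite muln1 -{1}(divnK LM) -[RHS](count_progression _ _ x L_gt0).
  apply: eq_bigr => k _; congr nat_of_bool.
  rewrite dvdzE /=; apply/forallP/dvdn_biglcmP => kP i.
    move=> _; rewrite -[(_ %| _)%N]/((d i)%:Z %| k%:Z - x)%Z.
    by rewrite -(subrKA (a i)) rpredD // -opprB rpredN.
  rewrite -(subrKA x) rpredD //; exact: kP.
rewrite muln0 big1 // => k _; apply/eqP; rewrite eqb0.
apply: contra ijP => /forallP kP.
rewrite -(subrKA k%:Z) rpredD //.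
  by rewrite -opprB rpredN; apply: dvdz_trans (kP i); rewrite dvdzE dvdn_gcdl.
by apply: dvdz_trans (kP j); rewrite dvdzE dvdn_gcdr.
Qed.

(** * Ramanujan sums *)

Definition cis {R : realType} (x : R) : R[i] := cos x +i* sin x.

Lemma cisD (R : realType) (x y : R) : cis (x + y) = cis x * cis y.
Proof.
rewrite /cis cosD sinD; apply/eqP; rewrite eq_complex /=.
by rewrite eqxx [_ + _ * sin y]addrC eqxx.
Qed.

Lemma cis0 (R : realType) : cis (0 : R) = 1.
Proof. by rewrite /cis cos0 sin0. Qed.

Lemma cisMn (R : realType) (x : R) (n : nat) : cis (x *+ n) = cis x ^+ n.
Proof.
elim: n => [|n IHn]; first by rewrite mulr0n cis0.
by rewrite mulrS exprS cisD IHn.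
Qed.

Lemma cis2pi (R : realType) : cis (pi *+ 2 : R) = 1.
Proof. by rewrite /cis cos2pi sin2pi. Qed.

Lemma cis2piz (R : realType) (z : int) : cis (pi *+ 2 * z%:~R : R) = 1.
Proof.
have natE n : cis (pi *+ 2 * n%:R : R) = 1.
  by rewrite mulr_natr cisMn cis2pi expr1n.
case: z => n; first exact: natE.
rewrite NegzE mulrNz mulrN -[LHS]mulr1 -(natE n.+1) -cisD.
by rewrite addNr cis0.
Qed.

(** For [0 < x < 2 pi], [sin (x / 2)] is positive, so [cos x = 1 - 2 sin (x / 2) ^ 2] is below 1. *)
Lemma cis_eq1 (R : realType) (x : R) : 0 <= x < pi *+ 2 -> cis x = 1 -> x = 0.
Proof.
case/andP=> x_ge0 x_lt [cosx _]; apply/eqP; apply: contraT => x_neq0.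
have x_gt0 : 0 < x by rewrite lt_neqAle eq_sym x_neq0.
have : 0 < sin (x / 2) by apply: sin_gt0_pi; move: x_lt; rewrite mulr2n; lra.
have : cos x = 1 - sin (x / 2) ^+ 2 *+ 2.
  rewrite [x in LHS]splitr cosD -!expr2 cos2sin2; ring.
rewrite cosx => sinE s_gt0; have := exprn_gt0 2 s_gt0.
by move: sinE; rewrite mulr2n; lra.
Qed.

Lemma cis_rat_eq1 (R : realType) (d : nat) (k : int) : (0 < d)%N ->
  (cis (pi *+ 2 * k%:~R / d%:R : R) == 1) = (d%:Z %| k)%Z.
Proof.
move=> d_gt0; have dR : (d%:R : R) != 0 by rewrite pnatr_eq0 -lt0n.
have dR_gt0 : (0 : R) < d%:R by rewrite ltr0n.
have pi2_gt0 : (0 : R) < pi *+ 2 by rewrite mulrn_wgt0 ?pi_gt0.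
apply/eqP/dvdzP => [|[z ->]]; last first.
  by rewrite intrM mulrA mulfK // cis2piz.
(* The quotient contributes full turns; the remainder gives an angle in [[0, 2 pi)]. *)
rewrite {1}(divz_eq k d%:Z); set q := (k %/ _)%Z; set t := (k %% _)%Z.
rewrite intrD intrM mulrDr mulrDl cisD mulrA mulfK // cis2piz mul1r.
have t_ge0 : 0 <= t by lia.
have t_lt : t < d%:Z by lia.
move/cis_eq1 => H; exists q; rewrite {1}(divz_eq k d%:Z) -/q -/t.
have /eqP : pi *+ 2 * t%:~R / d%:R = 0 :> R.
  apply: H; apply/andP; split.
    by rewrite divr_ge0 ?mulr_ge0 ?ler0z // ltW.
  by rewrite ltr_pdivrMr // ltr_pM2l // -[d%:R]/(d%:Z%:~R) ltr_int.
rewrite !mulf_eq0 invr_eq0 (negPf dR) (gt_eqF pi2_gt0) /= orbF intr_eq0.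
by move/eqP->; rewrite addr0.
Qed.

Lemma sum_cis (R : realType) (d : nat) (k : int) : (0 < d)%N ->
  \sum_(1 <= j < d.+1) cis (pi *+ 2 * k%:~R / d%:R : R) ^+ j
  = d%:R * (d%:Z %| k)%Z%:R.
Proof.
move=> d_gt0; rewrite -(cis_rat_eq1 R) //; set z := cis _.
have zd : z ^+ d = 1.
  by rewrite -cisMn -[_ *+ d]mulr_natr divfK ?cis2piz // pnatr_eq0 -lt0n.
rewrite big_add1 big_mkord /=; have [->|z_neq1] := eqVneq z 1.
  under eq_bigr do rewrite expr1n.
  by rewrite sumr_const card_ord mulr1.
(* Exponents start at 1: one factor [z] is pulled out, and the geometric sum left vanishes because
   [z ^+ d = 1]. *)
under eq_bigr do rewrite exprS.
rewrite mulr0 -mulr_sumr; apply/eqP; rewrite mulf_eq0; apply/orP; right.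
have /eqP := subrX1 z d.
by rewrite zd subrr eq_sym mulf_eq0 subr_eq0 (negPf z_neq1).
Qed.

Lemma expC_cis (R : realType) (n j : nat) (k : int) :
  expC (2 * (pi : R)%:C * 'i%R * j%:R * k%:~R / n%:R)
  = cis (pi *+ 2 * k%:~R / n%:R) ^+ j.
Proof.
rewrite -cisMn; set x := pi *+ 2 * _ / _ *+ j.
have -> : 2 * (pi : R)%:C * 'i%R * j%:R * k%:~R / n%:R = x%:C * 'i%C.
  rewrite complexiE /x; move: (pi : R) => p.
  rewrite rmorphMn !rmorphM rmorphMn fmorphV rmorph_nat rmorph_int.
  by rewrite /=; ring.
by rewrite /expC ReiNIm ImiRe /= oppr0 expR0 mul1r.
Qed.

(** The indicator of coprimality is the sum of [mobius e] over the common divisors [e] of [j] and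
    [n]; after the exchange of sums, [d = n / e]. *)
Lemma ramanujan_sumE (R : realType) (n : nat) (k : int) : (0 < n)%N ->
  ramanujan_sum R n k =
  \sum_(d <- divisors n)
    d%:R * (mobius (n %/ d))%:~R * (d%:Z %| k)%Z%:R.
Proof.
move=> n_gt0; rewrite /ramanujan_sum.
under eq_bigr do rewrite expC_cis.
rewrite big_mkcond /=; set w := cis _.
transitivity (\sum_(1 <= j < n.+1) \sum_(e <- divisors n | (e %| j)%N)
                 (mobius e)%:~R * w ^+ j).
  apply: eq_big_nat => j /andP[j_gt0 _]; rewrite -mulr_suml -(rmorph_sum intr).
  rewrite -big_filter (perm_big (divisors (gcdn j n))) /=; last first.
    have g_gt0 : (0 < gcdn j n)%N by rewrite gcdn_gt0 j_gt0.
    apply: uniq_perm; rewrite ?filter_uniq ?divisors_uniq // => e.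
    by rewrite mem_filter -!dvdn_divisors // dvdn_gcd.
  rewrite sum_mobius_divisors ?gcdn_gt0 ?j_gt0 // -/(coprime j n).
  by case: coprime; rewrite ?mul1r ?mul0r.
rewrite (exchange_big_dep xpredT) //=.
rewrite [RHS](perm_big _ (perm_divisors_compl _ n_gt0)) big_map.
apply: eq_big_seq => e; rewrite -dvdn_divisors // => /dvdnP[q nE].
have e_gt0 : (0 < e)%N by move: n_gt0; rewrite nE muln_gt0 => /andP[].
have q_gt0 : (0 < q)%N by move: n_gt0; rewrite nE muln_gt0 => /andP[].
rewrite -mulr_sumr [in RHS]nE mulnK // mulKn //.
rewrite [_ * _%:~R]mulrC -mulrA; congr (_ * _).
(* With [n = q * e], [w ^+ e] is [cis] at [2 pi k / q]: the multiples of [e] yield a full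
   orthogonality sum modulo [q]. *)
rewrite -(sum_cis R) // {1}nE mulnC big_multiples //; apply: eq_bigr => j _.
rewrite exprM; congr (_ ^+ _); rewrite -cisMn; congr cis.
rewrite nE natrM; field.
by rewrite !pnatr_eq0 -!lt0n e_gt0 q_gt0.
Qed.

(** * The mean value of a product of Ramanujan sums *)

Lemma lcm_fam_gt0 (r : nat) (m : 'I_r -> nat) :
  (forall i, (0 < m i)%N) -> (0 < lcm_fam m)%N.
Proof.
move=> m_gt0; apply: (big_ind (fun n => 0 < n)%N) => // x y x0 y0.
by rewrite lcmn_gt0 x0.
Qed.

(* A tuple (d_1, ..., d_r) of divisors of the m_i is a finite function with
   values in {0, ..., lcm m}: each divisor of m_i is at most m_i <= lcm m, and
   0 does not divide m_i > 0. *)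
Theorem corollary2 (R : realType) (r : nat) (r_gt0 : (0 < r)%N)
    (m : 'I_r -> nat) (m_gt0 : forall i, (0 < m i)%N) (a : 'I_r -> int) :
  ((lcm_fam m)%:R : R[i])^-1 *
    \sum_(1 <= k < (lcm_fam m).+1)
      \prod_(i < r) ramanujan_sum R (m i) (k%:Z - a i)
  = \sum_(d : {ffun 'I_r -> 'I_(lcm_fam m).+1} | [forall i, (d i %| m i)%N])
      (\prod_(i < r) ((d i)%:R * (mobius (m i %/ d i))%:~R))
        / (lcm_fam (fun i => d i))%:R
        * (N_compat a (fun i => d i))%:R.
Proof.
have M_gt0 := lcm_fam_gt0 _ _ m_gt0; set M := lcm_fam m in M_gt0 *.
have m_M i : (m i %| M)%N by rewrite /M /lcm_fam (biglcmn_sup i).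
transitivity (M%:R^-1 * \sum_(1 <= k < M.+1)
    \sum_(d : {ffun 'I_r -> 'I_M.+1} | [forall i, (d i %| m i)%N])
      (\prod_(i < r) ((d i)%:R * (mobius (m i %/ d i))%:~R))
      * [forall i, ((d i)%:Z %| k%:Z - a i)%Z]%:R : R[i]).
  congr (_ * _); apply: eq_bigr => k _.
  under eq_bigr => i _.
    rewrite ramanujan_sumE // (big_divisors_ord _ _ M) //; last exact: dvdn_leq.
    rewrite big_mkcond; over.
  (* Non-divisors count as zero terms, so a tuple with one bad entry has product 0. *)
  rewrite bigA_distr_bigA [RHS]big_mkcond; apply: eq_bigr => d _ /=.
  case: ifPn => [/forallP dm|/forallPn[i dmi]]; last first.
    by rewrite (bigD1 i) //= (negPf dmi) mul0r.
  under eq_bigr => i _ do rewrite dm.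
  rewrite big_split /=; congr (_ * _).
  case: (boolP [forall i, _]) => [/forallP dk|/forallPn[i dki]].
    by rewrite big1 // => i _; rewrite dk.
  by rewrite (bigD1 i) //= (negPf dki) mul0r.
rewrite exchange_big mulr_sumr; apply: eq_bigr => d /forallP dm /=.
have LM : (lcm_fam (fun i => d i) %| M)%N.
  by apply/dvdn_biglcmP => i _; apply: dvdn_trans (dm i) (m_M i).
have L_gt0 := dvdn_gt0 M_gt0 LM.
(* The quotient of [M] by the lcm is exact, so it becomes a field quotient and [M] cancels. *)
rewrite -mulr_sumr -natr_sum count_crt // natrM pchar0_natf_div //;
  last exact: pchar_num.
by field; rewrite !pnatr_eq0 -!lt0n M_gt0 L_gt0.
Qed.
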